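(* Let $\Delta>0$ be an even integer. Every $GL(r)$-configuration of dimension $\Delta$ has rank $r\le 3\Delta+6$. Moreover, the equality $r=3\Delta+6$ is achieved exactly by the configuration with $(q_1,q_2,q_3)=\left(\frac r2,\frac r3,\frac r6\right)$ whose three column partitions are $\left(\frac r2,\frac r2\right)$, $\left(\frac r3,\frac r3,\frac r3\right)$ and $\left(\frac r6,\frac r6,\frac r6,\frac r6,\frac r6,\frac r6-1,1\right)$.
   Context: A $GL(r)$-configuration (of rank $r$) consists of the following data: integers $q_1\ge q_2\ge q_3\ge 1$ with $q_1+q_2+q_3=r$ (column widths), and for each $i\in\{1,2,3\}$ a partition $r=\lambda_i^0+\lambda_i^1+\dots+\lambda_i^{s_i}$ into positive integers $\lambda_i^0\ge\lambda_i^1\ge\dots\ge\lambda_i^{s_i}$ with $\lambda_i^j\le q_i$ for all $j$ (the $i$-th column partition). Its dimension is $\Delta=r^2-\sum_{i=1}^3\sum_{j=0}^{s_i}(\lambda_i^j)^2$. *)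

(* Defs.v *)
From mathcomp Require Import all_boot all_order all_algebra.
Set Implicit Arguments.
Unset Strict Implicit.
Unset Printing Implicit Defensive.
Import GRing.Theory Num.Theory.

(* The entries at index i : 'I_3 are q_(i+1) and the (i+1)-th column partition,
   the latter as the list of its parts, sorted in nonincreasing order. *)
Record GL_data := GLData {
  widths : 3.-tuple nat;
  columns : 3.-tuple (seq nat)
}.

Definition is_partition (r : nat) (s : seq nat) : Prop :=
  [/\ sorted geq s, all (leq 1) s & sumn s = r].

Definition is_GL_configuration (r : nat) (C : GL_data) : Prop :=
  [/\ sorted geq (widths C),
      all (leq 1) (widths C),
      sumn (widths C) = r,
      forall i : 'I_3, is_partition r (tnth (columns C) i)
    & forall (i : 'I_3) (l : nat),
        l \in tnth (columns C) i -> l <= tnth (widths C) i].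

(* int-valued, so that the subtraction is not truncated *)
Definition GL_dim (r : nat) (C : GL_data) : int :=
  (r%:Z ^+ 2
   - \sum_(i < 3) \sum_(l <- tnth (columns C) i) l%:Z ^+ 2)%R.

(* Only meaningful when 6 divides r, in which case all the quotients are
   exact; this holds for r = 3 * Delta + 6 with Delta even. *)
Definition extremal_configuration (r : nat) : GL_data :=
  GLData
    [tuple r %/ 2; r %/ 3; r %/ 6]
    [tuple [:: r %/ 2; r %/ 2];
           [:: r %/ 3; r %/ 3; r %/ 3];
           [:: r %/ 6; r %/ 6; r %/ 6; r %/ 6; r %/ 6; r %/ 6 - 1; 1]].

(* Main.v *)
Require Import Defs.
From mathcomp Require Import all_boot all_order all_algebra.
From mathcomp Require Import zify.

(** Since [q1 + q2 + q3 = r], the dimension is the sum over all parts [l] of all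
    columns of [l * (q_i - l)], and every part [l < q_i] contributes at least
    [q_i - 1].  A defective part in a column of width at least [r / 3] is thus
    too expensive, which leaves [q1 = r / 2] without defect in column 1.  If
    column 2 has exactly one defective part and [q2 < r / 3], it contributes
    [2 * x * y], where [x = q2 - q3] and [y = 2 * q3 - q2], against
    [r = 6 * x + 4 * y]; two defective parts are too expensive.  If it has none,
    then [q2] is [2 * q3] or [q3], so [q3] divides [r] and column 3 has at least
    two defective parts. *)

(** The residue [l] modulo [q] is nonzero. This rules out a single defective part when the width
    divides the rank. *)
Lemma addn_mul_neq k n q l : 0 < l < q -> k * q + l <> n * q.
Proof.
move=> lq /(congr1 (modn^~ q)); rewrite modnMDl modnMl modn_small; lia.
Qed.

Definition defect (q : nat) (s : seq nat) : nat := \sum_(l <- s) l * (q - l).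

Lemma sum_sqr_defect q s : all (geq q) s ->
  \sum_(l <- s) l ^ 2 + defect q s = q * sumn s.
Proof.
move=> /allP le_q; rewrite /defect -big_split sumnE big_distrr /=.
by apply: eq_big_seq => l /le_q /= lq; nia.
Qed.

(** Termwise, [l * (q - l) - (q - 1) = (l - 1) * (q - l - 1)], a product of nonnegative factors. *)
Lemma defect_ge q s : all (fun l => 0 < l < q) s ->
  size s * q.-1 <= defect q s.
Proof.
rewrite /defect; elim: s => [|l s IHs] /=; first by rewrite big_nil.
by move=> /andP[lq /IHs]; rewrite big_cons; nia.
Qed.

Lemma perm_full_defective q s : all (fun l => 0 < l <= q) s ->
  exists k d, perm_eq s (nseq k q ++ d) /\ all (fun l => 0 < l < q) d.
Proof.
move=> /allP sq; exists (count_mem q s), (filter (predC (pred1 q)) s); split.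
  rewrite -(perm_filterC (pred1 q) s) perm_cat2r.
  suff -> : filter (pred1 q) s = nseq (count_mem q s) q by [].
  by rewrite -size_filter; apply/all_pred1P/filter_all.
by apply/allP => l; rewrite mem_filter /= => /andP[l_neq /sq]; lia.
Qed.

Lemma defect_perm_full q s k d :
  perm_eq s (nseq k q ++ d) -> defect q s = defect q d.
Proof.
move=> eq_s; rewrite /defect (perm_big _ eq_s) big_cat big_nseq /=.
by rewrite subnn muln0 iter_addn_0 mul0n.
Qed.

Lemma sumn_perm_full q s k d :
  perm_eq s (nseq k q ++ d) -> sumn s = k * q + sumn d.
Proof. by move=> /perm_sumn ->; rewrite sumn_cat sumn_nseq mulnC. Qed.

(** The cases are zero, one, or at least two defective parts. A single one keeps its exact
    contribution, from which the bound for column 2 is computed. *)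
Lemma defect_cases q s : all (fun l => 0 < l <= q) s ->
  [\/ defect q s = 0 /\ exists k, sumn s = k * q,
      exists k l, [/\ 0 < l < q, sumn s = k * q + l & defect q s = l * (q - l)]
    | 2 * q.-1 <= defect q s].
Proof.
move=> /perm_full_defective[k [d [eq_s dq]]].
rewrite (defect_perm_full _ _ _ _ eq_s) (sumn_perm_full _ _ _ _ eq_s).
have := defect_ge _ _ dq.
case: d dq {eq_s} => [|l [|l' d]] /=.
- by move=> _ _; constructor 1; rewrite /defect big_nil; split=> //; exists k; lia.
- rewrite andbT => lq _; constructor 2; exists k, l.
  by rewrite /defect big_seq1 addn0.
- by move=> _ le_d; constructor 3; apply: leq_trans le_d; rewrite leq_mul2r orbT.
Qed.

Lemma defect0_nseq q s : all (fun l => 0 < l <= q) s -> defect q s = 0 ->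
  exists k, s = nseq k q.
Proof.
move=> sq s0; exists (size s); apply/all_pred1P/allP => l ls /=.
have := allP sq _ ls; move/eqP: s0; rewrite /defect sum_nat_seq_eq0.
by move=> /allP/(_ _ ls) /=; nia.
Qed.

Lemma rank_le_defect q1 q2 q3 s1 s2 s3 (r := q1 + q2 + q3)
    (D := defect q1 s1 + defect q2 s2 + defect q3 s3) :
  0 < q3 <= q2 -> q2 <= q1 ->
  all (fun l => 0 < l <= q1) s1 -> all (fun l => 0 < l <= q2) s2 ->
  all (fun l => 0 < l <= q3) s3 ->
  sumn s1 = r -> sumn s2 = r -> sumn s3 = r -> 0 < D ->
  r <= 3 * D + 6 /\
  (r = 3 * D + 6 ->
   [/\ q1 = 3 * q3, q2 = 2 * q3, defect q1 s1 = 0 & defect q2 s2 = 0]).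
Proof.
move=> q32 q21 /defect_cases c1 /defect_cases c2 /defect_cases c3 r1 r2 r3.
move: c1 c2 c3; rewrite r1 r2 r3 /D {D r1 r2 r3}/r.
move: (defect q1 s1) (defect q2 s2) (defect q3 s3) => D1 D2 D3 c1 c2 c3 D_gt0.
have [le_D1|D1_0] : q1 <= D1 + 1 \/ D1 = 0 /\ exists k, q1 + q2 + q3 = k * q1.
  by case: c1 => [?|[k [l [? _ ->]]]|?]; [right|left; nia|left; lia].
(* Here [r <= 3 * q1 <= 3 * D1 + 3], so equality cannot occur. *)
- by split=> //; lia.
have {D1_0 c1}[D1_0 [k Dk]] := D1_0.
have {k Dk}[q1E|[q1E q2E]] : q1 = q2 + q3 \/ q1 = q3 /\ q2 = q3.
(* Since [q1 < r <= 3 * q1], only [k = 2] and [k = 3] remain. *)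
- by case: k Dk => [|[|[|[|k]]]] ?; nia.
- have c2' : D2 = 0 \/ q2 <= D2 + 1.
    by case: c2 => [[? _]|[k [l [? _ ->]]]|?]; [left|right; nia|right; lia].
  case: c2 => [[D2_0 [k Dk]]|[k [l [lq Dk D2E]]]|D2_ge]; last by split; lia.
  + have q2E : q2 = 2 * q3 \/ q2 = q3.
      by case: k Dk => [|[|[|[|[|k]]]]] ?; nia.
    (* [D3] is positive because [D1 = D2 = 0], and [r] is [6 * q3] or [4 * q3], which excludes a
       single defective part. *)
    have {c3} : 2 * q3.-1 <= D3.
      case: c3 => [[? _]|[k' [l [lq Dk' _]]]|//]; first by lia.
      exfalso; case: q2E => q2E.
        by apply: (addn_mul_neq k' 6 _ _ lq); lia.
      by apply: (addn_mul_neq k' 4 _ _ lq); lia.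
    by case: q2E => ?; split=> [|?]; [lia|split; lia|lia|split; lia].
  (* If [2 * q3 <= q2], then [r <= 3 * q2 <= 3 * D2 + 3]. *)
  + have [?|?] := leqP (2 * q3) q2; first by split; lia.
    have lE : l + q2 = 2 * q3.
      by case: k Dk => [|[|[|[|k]]]] ?; nia.
    (* Off by one: [x.+1] is the difference [q2 - q3], positive because [l < q2], while [l] is
       [2 * q3 - q2]. *)
    have [x q2E] : exists x, q2 = q3 + x.+1 by exists (q2 - q3).-1; lia.
    have q3E : q3 = l + x.+1 by lia.
    have qlE : q2 - l = 2 * x.+1 by lia.
    (* This gives [3 * D2 + 6 >= 6 * x + 6 * l + 6 > 6 * x.+1 + 4 * l = r]. *)
    have x_le : x <= l * x by rewrite leq_pmull //; lia.
    have {D2E} : D2 = 2 * (l * x) + 2 * l by rewrite D2E qlE; lia.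
    by split=> [|rE]; [lia | exfalso; lia].
(* All widths equal [q3], and a positive [D2] or [D3] is at least [q3 - 1], so
   [r = 3 * q3 <= 3 * D + 3]. *)
- have {c2} : D2 = 0 \/ q2 <= D2 + 1.
    by case: c2 => [[? _]|[k [l [? _ ->]]]|?]; [left|right; nia|right; lia].
  have {c3} : D3 = 0 \/ q3 <= D3 + 1.
    by case: c3 => [[? _]|[k [l [? _ ->]]]|?]; [left|right; nia|right; lia].
  by split; lia.
Qed.

(** The defect is the least that two defective parts can give, so three are too many; it is
    positive, so there is at least one, and divisibility excludes exactly one. *)
Lemma two_defects_unique m s : 1 < m -> sorted geq s ->
  all (fun l => 0 < l <= m) s -> sumn s = 6 * m -> defect m s = 2 * m.-1 ->
  s = [:: m; m; m; m; m; m - 1; 1].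
Proof.
move=> m_gt1 s_sorted /perm_full_defective[k [d [eq_s dm]]].
rewrite (sumn_perm_full _ _ _ _ eq_s) (defect_perm_full _ _ _ _ eq_s) => sumE dE.
apply: (sorted_eq (leT := geq)) => //.
- by move=> x y z /= xy yz; apply: leq_trans yz xy.
- by move=> x y /= /anti_leq.
- by rewrite /=; lia.
apply: perm_trans eq_s _.
have := defect_ge _ _ dm; rewrite {1}dE => /leP d_le.
case: d dm sumE dE d_le => [|x [|y [|z d]]]; rewrite /defect ?big_cons ?big_nil /=.
- by lia.
- by rewrite andbT => xm; rewrite addn0 => /(addn_mul_neq _ _ _ _ xm).
- move=> dm sumE dE _.
  have k5 : k = 5.
    have [?|?|//] := ltngtP k 5.
      by have := leq_mul2r m k 4; lia.
    by have := leq_mul2r m 6 k; lia.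
  subst k; have xyE : x + y = m by lia.
  (* As [x + y = m], the defect is [2 * x * y], whence [(x - 1) * (y - 1) = 0]. *)
  have [[-> ->]|[-> ->]] : x = 1 /\ y = m - 1 \/ x = m - 1 /\ y = 1 by nia.
  + by rewrite -(perm_cat2l (nseq 5 m)) /= !perm_cons (perm_catC [:: 1] [:: m - 1]).
  + exact: perm_refl.
- by move=> *; nia.
Qed.

Lemma GL_configuration_columns r C : is_GL_configuration r C ->
  exists q1 q2 q3 s1 s2 s3,
    [/\ C = GLData [tuple q1; q2; q3] [tuple s1; s2; s3],
        [/\ 0 < q3 <= q2, q2 <= q1 & q1 + q2 + q3 = r],
        [/\ sorted geq s1, all (fun l => 0 < l <= q1) s1 & sumn s1 = r],
        [/\ sorted geq s2, all (fun l => 0 < l <= q2) s2 & sumn s2 = r]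
      & [/\ sorted geq s3, all (fun l => 0 < l <= q3) s3 & sumn s3 = r]].
Proof.
case: C => -[[|q1 [|q2 [|q3 [|? ?]]]] //= sz_q] [[|s1 [|s2 [|s3 [|? ?]]]] //= sz_s].
case=> /= q_sorted q_gt0 q_sum parts le_width.
have column (i : 'I_3) : let q := nth 0 [:: q1; q2; q3] i in
    let s := nth [::] [:: s1; s2; s3] i in
    [/\ sorted geq s, all (fun l => 0 < l <= q) s & sumn s = r].
  have := parts i; have := le_width i; rewrite (tnth_nth 0) (tnth_nth [::]) /=.
  move=> le_i [-> /allP gt0_i ->]; split=> //; apply/allP => l ls.
  by rewrite le_i // andbT; apply: gt0_i.
exists q1, q2, q3, s1, s2, s3; split.
- by congr GLData; apply: val_inj.
- by split=> //; lia.
- exact: (column ord0).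
- exact: (column (Ordinal (isT : 1 < 3))).
- exact: (column ord_max).
Qed.

(** In each column the squares sum to [q * r] minus the defect, and the three products [q * r] add
    up to [r ^ 2]. *)
Lemma GL_dim_defect q1 q2 q3 s1 s2 s3 (r := q1 + q2 + q3) :
  all (fun l => 0 < l <= q1) s1 -> all (fun l => 0 < l <= q2) s2 ->
  all (fun l => 0 < l <= q3) s3 ->
  sumn s1 = r -> sumn s2 = r -> sumn s3 = r ->
  GL_dim r (GLData [tuple q1; q2; q3] [tuple s1; s2; s3])
    = Posz (defect q1 s1 + defect q2 s2 + defect q3 s3).
Proof.
have column q s : all (fun l => 0 < l <= q) s -> sumn s = r ->
    (\sum_(l <- s) l%:Z ^+ 2 = (q * r)%:Z - (defect q s)%:Z)%R.
  move=> sq <-; rewrite -sum_sqr_defect; last first.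
    by apply: sub_all sq => l /andP[].
  by rewrite PoszD GRing.addrK (big_morph Posz PoszD (erefl (Posz 0))).
move=> sq1 sq2 sq3 r1 r2 r3; rewrite /GL_dim !big_ord_recl big_ord0 /=.
rewrite !(tnth_nth [::]) /= (column _ _ sq1 r1) (column _ _ sq2 r2) (column _ _ sq3 r3).
by rewrite /r; lia.
Qed.

Theorem theorem2p7 (Delta : nat) (Delta_gt0 : 0 < Delta)
    (Delta_even : ~~ odd Delta) :
  (forall (r : nat) (C : GL_data),
     is_GL_configuration r C -> GL_dim r C = Posz Delta ->
     r <= 3 * Delta + 6)
  /\
  (forall C : GL_data,
     is_GL_configuration (3 * Delta + 6) C
       /\ GL_dim (3 * Delta + 6) C = Posz Delta
     <-> C = extremal_configuration (3 * Delta + 6)).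
Proof.
split=> [r C|C].
  case/GL_configuration_columns=> q1 [q2 [q3 [s1 [s2 [s3]]]]].
  case=> -> [q32 q21 <-] [_ sq1 r1] [_ sq2 r2] [_ sq3 r3].
  rewrite GL_dim_defect // => -[dimE]; rewrite -dimE in Delta_gt0 *.
  by have [] := rank_le_defect _ _ _ _ _ _ q32 q21 sq1 sq2 sq3 r1 r2 r3 Delta_gt0.
have [m DE] : exists m, Delta = 2 * m by exists Delta./2; lia.
have -> : 3 * Delta + 6 = 6 * m.+1 by lia.
have -> : extremal_configuration (6 * m.+1) =
    GLData [tuple 3 * m.+1; 2 * m.+1; m.+1]
      [tuple nseq 2 (3 * m.+1); nseq 3 (2 * m.+1);
             [:: m.+1; m.+1; m.+1; m.+1; m.+1; m; 1]].
  rewrite /extremal_configuration.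
  have -> : 6 * m.+1 %/ 2 = 3 * m.+1 by lia.
  have -> : 6 * m.+1 %/ 3 = 2 * m.+1 by lia.
  have -> : 6 * m.+1 %/ 6 = m.+1 by lia.
  by rewrite subn1.
split=> [[] | ->].
  case/GL_configuration_columns=> q1 [q2 [q3 [s1 [s2 [s3]]]]].
  case=> -> [q32 q21 rE]; rewrite -rE.
  move=> [_ sq1 r1] [_ sq2 r2] [s3_sorted sq3 r3].
  rewrite GL_dim_defect // => -[dimE].
  have dim_gt0 := Delta_gt0; rewrite -dimE in dim_gt0.
  have [_ []] :=
    rank_le_defect _ _ _ _ _ _ q32 q21 sq1 sq2 sq3 r1 r2 r3 dim_gt0.
    by rewrite dimE; lia.
  move=> q1E q2E d1 d2.
  have q3E : q3 = m.+1 by lia.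
  have [k1 s1E] := defect0_nseq _ _ sq1 d1.
  have [k2 s2E] := defect0_nseq _ _ sq2 d2.
  (* The whole dimension [2 * m = 2 * q3.-1] falls on column 3, and [1 < q3] follows from
     [Delta_gt0]. *)
  have s3E : s3 = [:: q3; q3; q3; q3; q3; q3 - 1; 1].
    by apply: two_defects_unique => //; lia.
  subst; move: r1 r2; rewrite !sumn_nseq => r1 r2.
  have -> : k1 = 2 by nia.
  have -> : k2 = 3 by nia.
  by rewrite subn1.
split.
  split=> /=; [lia | lia | lia | |].
    by case=> -[|[|[|//]]] i; rewrite (tnth_nth [::]) /=; split=> //=; lia.
  case=> -[|[|[|//]]] i l; rewrite (tnth_nth [::]) (tnth_nth 0) !inE /=; lia.
have -> : 6 * m.+1 = 3 * m.+1 + 2 * m.+1 + m.+1 by lia.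
rewrite GL_dim_defect /=; try lia.
(* Only the parts [m] and [1] of column 3 are defective; each contributes [m]. *)
by rewrite /defect !big_cons !big_nil; lia.
Qed.
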